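(* Let $\square\mathbf{T}:=\mathbf{K}+\square(\square p\to p)$ and $\mathbf{SL4}:=\mathbf{K4}+(\Diamond p\leftrightarrow\square p)$. If $\Lambda$ is a normal propositional monomodal logic with $\square\mathbf{T}\subseteq\Lambda\subseteq\mathbf{SL4}$, then $\Lambda$ and $\mathbf{S5}$ are not semiproduct-matching, i.e. $[\Lambda,\mathbf{S5}]^{\mathrm{EX}}\neq\Lambda\rightthreetimes\mathbf{S5}$.
   Context: All propositional modal logics are normal. $\Lambda$ is in the language with the modality $\square$ (dual $\Diamond$), and $\mathbf{S5}$ is in the language with the modality $\blacksquare$. $L+A$ denotes the smallest normal modal logic containing $L$ and the formula $A$; $\mathbf{K}$ is the minimal normal modal logic and $\mathbf{K4}=\mathbf{K}+(\square p\to\square\square p)$. $[\Lambda,\mathbf{S5}]^{\mathrm{EX}}$ is the bimodal logic $\Lambda*\mathbf{S5}+(\square\blacksquare p\to\blacksquare\square p)$, where $*$ denotes fusion (the smallest normal bimodal logic containing both). The product of Kripke frames $F_1=(U_1,R_1)$ and $F_2=(U_2,R_2)$ is $F_1\times F_2:=(U_1\times U_2,R_h,R_v)$ with $R_h(u,v)=R_1(u)\times\{v\}$ and $R_v(u,v)=\{u\}\times R_2(v)$, where $R(x)=\{y\mid xRy\}$. A semiproduct of $F_1$ and $F_2$ is a restriction of $F_1\times F_2$ to a nonempty subset $W\subseteq U_1\times U_2$ such that $R_h(W)\subseteq W$. The modality $\square$ is interpreted by $R_h$ and $\blacksquare$ by $R_v$. The semiproduct $\Lambda\rightthreetimes\mathbf{S5}$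 is the bimodal logic (set of valid formulas) of the class of all semiproducts of $\Lambda$-frames with $\mathbf{S5}$-frames (an $L$-frame is a Kripke frame validating $L$). *)

(* Defs.v *)
From Stdlib Require Export Ensembles Image.

(* The type M is the set of modalities: [unit] for a monomodal language,
   [bimodality] for the bimodal one. *)
Inductive form (M : Type) : Type :=
| Var : nat -> form M
| Bot : form M
| Imp : form M -> form M -> form M
| Box : M -> form M -> form M.

Arguments Var {M} _.
Arguments Bot {M}.
Arguments Imp {M} _ _.
Arguments Box {M} _ _.

Definition Neg {M : Type} (A : form M) : form M := Imp A Bot.
Definition And {M : Type} (A B : form M) : form M := Neg (Imp A (Neg B)).
Definition Iff {M : Type} (A B : form M) : form M := And (Imp A B) (Imp B A).
Definition Dia {M : Type} (m : M) (A : form M) : form M := Neg (Box m (Neg A)).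

Inductive bimodality : Type := hor | ver.

Fixpoint subst {M : Type} (s : nat -> form M) (A : form M) : form M :=
  match A with
  | Var n => s n
  | Bot => Bot
  | Imp B C => Imp (subst s B) (subst s C)
  | Box m B => Box m (subst s B)
  end.

Fixpoint rename {M N : Type} (f : M -> N) (A : form M) : form N :=
  match A with
  | Var n => Var n
  | Bot => Bot
  | Imp B C => Imp (rename f B) (rename f C)
  | Box m B => Box (f m) (rename f B)
  end.

(* Boxed formulas are treated as atoms, so the tautologies are exactly the
   substitution instances of classical propositional tautologies. *)
Fixpoint truth {M : Type} (v : form M -> bool) (A : form M) : bool :=
  match A with
  | Bot => false
  | Imp B C => implb (truth v B) (truth v C)
  | _ => v A
  end.

Definition tautology {M : Type} (A : form M) : Prop :=
  forall v : form M -> bool, truth v A = true.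

Record normal_logic {M : Type} (L : Ensemble (form M)) : Prop := {
  normal_taut : forall A, tautology A -> In _ L A;
  normal_K : forall m, In _ L
    (Imp (Box m (Imp (Var 0) (Var 1))) (Imp (Box m (Var 0)) (Box m (Var 1))));
  normal_mp : forall A B, In _ L (Imp A B) -> In _ L A -> In _ L B;
  normal_subst : forall s A, In _ L A -> In _ L (subst s A);
  normal_nec : forall m A, In _ L A -> In _ L (Box m A)
}.

Definition least_normal {M : Type} (X : Ensemble (form M)) : Ensemble (form M) :=
  fun A => forall L, normal_logic L -> Included _ X L -> In _ L A.

Definition plus {M : Type} (L : Ensemble (form M)) (A : form M) :
  Ensemble (form M) := least_normal (Union _ L (Singleton _ A)).

Definition K : Ensemble (form unit) := least_normal (Empty_set _).

Section MonomodalAxioms.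
Let p : form unit := Var 0.
Let box := @Box unit tt.
Let dia := @Dia unit tt.

Definition K4 := plus K (Imp (box p) (box (box p))).
Definition boxT := plus K (box (Imp (box p) p)).
Definition SL4 := plus K4 (Iff (dia p) (box p)).
Definition S4 := plus K4 (Imp (box p) p).
Definition S5 := plus S4 (Imp (dia (box p)) p).
End MonomodalAxioms.

Definition fusion (L1 L2 : Ensemble (form unit)) : Ensemble (form bimodality) :=
  least_normal (Union _ (Im _ _ L1 (rename (fun _ => hor)))
                        (Im _ _ L2 (rename (fun _ => ver)))).

Definition EX (L1 L2 : Ensemble (form unit)) : Ensemble (form bimodality) :=
  plus (fusion L1 L2)
    (Imp (Box hor (Box ver (Var 0))) (Box ver (Box hor (Var 0)))).

Record frame (M : Type) : Type := {
  world : Type;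
  rel : M -> world -> world -> Prop;
  frame_nonempty : inhabited world
}.
Arguments world {M} _.
Arguments rel {M} _ _ _ _.
Arguments frame_nonempty {M} _.

Fixpoint forces {M : Type} (F : frame M) (V : nat -> world F -> Prop)
  (x : world F) (A : form M) : Prop :=
  match A with
  | Var n => V n x
  | Bot => False
  | Imp B C => forces F V x B -> forces F V x C
  | Box m B => forall y, rel F m x y -> forces F V y B
  end.

Definition valid {M : Type} (F : frame M) (A : form M) : Prop :=
  forall (V : nat -> world F -> Prop) (x : world F), forces F V x A.

Definition frame_of {M : Type} (L : Ensemble (form M)) (F : frame M) : Prop :=
  forall A, In _ L A -> valid F A.

Definition product_rel (F1 F2 : frame unit) (m : bimodality)
  (x y : world F1 * world F2) : Prop :=
  match m with
  | hor => rel F1 tt (fst x) (fst y) /\ snd x = snd y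
  | ver => fst x = fst y /\ rel F2 tt (snd x) (snd y)
  end.

Definition product (F1 F2 : frame unit) : frame bimodality := {|
  world := (world F1 * world F2)%type;
  rel := product_rel F1 F2;
  frame_nonempty :=
    match frame_nonempty F1, frame_nonempty F2 with
    | inhabits u, inhabits v => inhabits (u, v)
    end
|}.

Definition restriction {M : Type} (F : frame M) (W : Ensemble (world F))
  (W_nonempty : Inhabited _ W) : frame M := {|
  world := {x : world F | In _ W x};
  rel := fun m x y => rel F m (proj1_sig x) (proj1_sig y);
  frame_nonempty :=
    match W_nonempty with
    | Inhabited_intro _ _ x Wx => inhabits (exist _ x Wx)
    end
|}.

Definition hor_closed (F1 F2 : frame unit)
  (W : Ensemble (world (product F1 F2))) : Prop :=
  forall x y, In _ W x -> rel (product F1 F2) hor x y -> In _ W y.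

Definition semiproduct_logic (L1 L2 : Ensemble (form unit)) :
  Ensemble (form bimodality) :=
  fun A => forall (F1 F2 : frame unit) (W : Ensemble (world (product F1 F2)))
    (W_nonempty : Inhabited _ W),
    frame_of L1 F1 -> frame_of L2 F2 -> hor_closed F1 F2 W ->
    valid (restriction (product F1 F2) W W_nonempty) A.

Definition semiproduct_matching (L1 L2 : Ensemble (form unit)) : Prop :=
  Same_set _ (EX L1 L2) (semiproduct_logic L1 L2).

(* Main.v *)
Require Import Defs.
From Stdlib Require Import Bool.
From Stdlib Require List.
Import List.ListNotations.

(** The separating formula is [hor]([ver]([hor] p -> p)).  If every point of a
    horizontal frame [F1] that has a predecessor is reflexive, then so is, in any
    semiproduct, every point vertically reachable from a horizontal successor,
    because the two share their first coordinate.  The formula fails in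
    the frame consisting of one vertical cluster {a, b} in which b is the
    only horizontal successor of both a and b; this frame validates
    EX(SL4, S5), hence EX(Lambda, S5). *)

(* Kripke semantics on an image-finite frame, given by lists of successors;
   boolean truth values keep the soundness of tautologies constructive. *)
Fixpoint eval {M W : Type} (succ : M -> W -> list W) (V : nat -> W -> bool)
  (A : form M) (x : W) : bool :=
  match A with
  | Var n => V n x
  | Bot => false
  | Imp B C => implb (eval succ V B x) (eval succ V C x)
  | Box m B => List.forallb (eval succ V B) (succ m x)
  end.

Definition succ_logic {M W : Type} (succ : M -> W -> list W) :
  Ensemble (form M) := fun A => forall V x, eval succ V A x = true.

Lemma forallb_ext {T : Type} (f g : T -> bool) (s : list T) :
  (forall x, f x = g x) -> List.forallb f s = List.forallb g s.
Proof. intros fg; induction s as [|x s IH]; simpl; [easy|now rewrite fg, IH]. Qed.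

(** At a fixed point [eval] is a propositional valuation with boxed formulas as atoms, so
    tautologies hold there. *)
Lemma eval_truth {M W : Type} (succ : M -> W -> list W) V (A : form M) x :
  eval succ V A x = truth (fun B => eval succ V B x) A.
Proof. induction A as [n| |B IHB C IHC|m B IH]; simpl; congruence. Qed.

Lemma eval_subst {M W : Type} (succ : M -> W -> list W) V s (A : form M) x :
  eval succ V (subst s A) x = eval succ (fun n => eval succ V (s n)) A x.
Proof.
revert x; induction A as [n| |B IHB C IHC|m B IH]; intros x; simpl; try easy.
- now rewrite IHB, IHC.
- now apply forallb_ext.
Qed.

Lemma eval_rename {M N W : Type} (succ : N -> W -> list W) V (f : M -> N) A x :
  eval succ V (rename f A) x = eval (fun m => succ (f m)) V A x.
Proof.
revert x; induction A as [n| |B IHB C IHC|m B IH]; intros x; simpl; try easy.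
- now rewrite IHB, IHC.
- now apply forallb_ext.
Qed.

Lemma succ_logic_normal {M W : Type} (succ : M -> W -> list W) :
  normal_logic (succ_logic succ).
Proof.
split.
- intros A tA V x; rewrite eval_truth; apply tA.
- intros m V x; simpl.
  induction (succ m x) as [|y s IH]; simpl; [easy|].
  now destruct (V 0 y), (V 1 y); simpl; rewrite ?implb_true_r.
- intros A B AB hA V x; specialize (AB V x); specialize (hA V x).
  simpl in AB; now rewrite hA in AB.
- intros s A hA V x; rewrite eval_subst; apply hA.
- intros m A hA V x; simpl; apply List.forallb_forall; intros y _; apply hA.
Qed.

Lemma least_normal_incl {M : Type} (X L : Ensemble (form M)) :
  normal_logic L -> Included _ X L -> Included _ (least_normal X) L.
Proof. intros nL XL A hA; now apply hA. Qed.

Lemma K_incl (L : Ensemble (form unit)) : normal_logic L -> Included _ K L.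
Proof. intros nL; apply least_normal_incl; [easy|intros A []]. Qed.

Lemma plus_incl {M : Type} (L L' : Ensemble (form M)) (A : form M) :
  normal_logic L' -> Included _ L L' -> In _ L' A -> Included _ (plus L A) L'.
Proof.
intros nL' LL' hA; apply least_normal_incl; [easy|].
intros B [C hC|C []]; [now apply LL'|easy].
Qed.

Lemma plus_axiom {M : Type} (L : Ensemble (form M)) (A : form M) :
  In _ (plus L A) A.
Proof. intros L' _ incl; apply incl; right; constructor. Qed.

(** A renamed generator of the fusion sees only one of the two successor functions. *)
Lemma fusion_succ_logic {W : Type} (succ : bimodality -> W -> list W)
  (L1 L2 : Ensemble (form unit)) :
  Included _ L1 (succ_logic (fun _ => succ hor)) ->
  Included _ L2 (succ_logic (fun _ => succ ver)) ->
  Included _ (fusion L1 L2) (succ_logic succ).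
Proof.
intros h1 h2; apply least_normal_incl; [apply succ_logic_normal|].
intros A [B [C hC D ->]|B [C hC D ->]] V x; rewrite eval_rename.
- now apply h1.
- now apply h2.
Qed.

(** Here [true] is the point b and [false] the point a. *)
Definition cluster_succ (m : bimodality) (_ : bool) : list bool :=
  match m with
  | hor => [true]
  | ver => [true; false]
  end.

Lemma SL4_cluster : Included _ SL4 (succ_logic (fun _ => cluster_succ hor)).
Proof.
pose proof (succ_logic_normal (fun _ : unit => cluster_succ hor)) as nL.
repeat (apply plus_incl; [exact nL| |]); [now apply K_incl| |];
  intros V x; simpl; now destruct (V 0 true).
Qed.

Lemma S5_cluster : Included _ S5 (succ_logic (fun _ => cluster_succ ver)).
Proof.
pose proof (succ_logic_normal (fun _ : unit => cluster_succ ver)) as nL.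
repeat (apply plus_incl; [exact nL| |]); [now apply K_incl| | |];
  intros V [|]; simpl; now destruct (V 0 true), (V 0 false).
Qed.

Lemma EX_cluster (L : Ensemble (form unit)) :
  Included _ L SL4 -> Included _ (EX L S5) (succ_logic cluster_succ).
Proof.
intros LSL4; apply plus_incl; [apply succ_logic_normal| |].
- apply fusion_succ_logic; [|exact S5_cluster].
  intros A hA; now apply SL4_cluster, LSL4.
(* From any point, [hor] then [ver] reaches both points, while [ver] then [hor] reaches only
   [true]. *)
- intros V x; simpl; now destruct (V 0 true), (V 0 false).
Qed.

Definition box_ver_T : form bimodality :=
  Box hor (Box ver (Imp (Box hor (Var 0)) (Var 0))).

Lemma box_ver_T_not_cluster : ~ In _ (succ_logic cluster_succ) box_ver_T.
(* Let p hold at [true] only: then [false], reached from [true] by [hor] and then [ver], satisfies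
   [Box hor p] but not p. *)
Proof. intros h; discriminate (h (fun _ x => x) true). Qed.

Lemma boxT_frame_refl (F : frame unit) (x y : world F) :
  frame_of boxT F -> rel F tt x y -> rel F tt y y.
Proof.
intros FT xy.
(* Minimal valuation: p holds exactly at the successors of [y], so [box p] is trivial at [y] and p
   says that [y] sees itself. *)
exact (FT _ (plus_axiom _ _) (fun _ z => rel F tt y z) x y xy (fun _ yz => yz)).
Qed.

Lemma box_ver_T_semiproduct (L1 L2 : Ensemble (form unit)) :
  Included _ boxT L1 -> In _ (semiproduct_logic L1 L2) box_ver_T.
Proof.
intros TL1 F1 F2 W W0 F1L1 _ _ V x y [xy _] z [yz _] boxp.
apply boxp; split; [|reflexivity].
(* The vertical step keeps the first coordinate, so reflexivity at [y] passes to [z]. *)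
rewrite <- yz; apply (boxT_frame_refl F1 (fst (proj1_sig x))); [|exact xy].
intros A hA; now apply F1L1, TL1.
Qed.

Theorem theorem3p1 (Lambda : Ensemble (form unit)) (normal_Lambda : normal_logic Lambda)
  (boxT_Lambda : Included _ boxT Lambda) (Lambda_SL4 : Included _ Lambda SL4) :
  ~ semiproduct_matching Lambda S5.
Proof.
(* The inclusion that fails is that of the semiproduct logic in [EX Lambda S5]. *)
intros [_ complete]; apply box_ver_T_not_cluster.
now apply (EX_cluster Lambda), complete, box_ver_T_semiproduct.
Qed.
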